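(* Let $n\ge1$ and $\mathbf{P}_A,\mathbf{P}_B,\mathbf{Q}_A,\mathbf{Q}_B\in\mathbb{R}^{n\times n}$ be symmetric positive definite. If $\mathbf{B}$ is a symmetric positive definite matrix such that $\mathcal{E}(\mathbf{B})$ tightly circumscribes $\mathcal{V}^*$, then there exists $\omega_1\in[0,1]$ such that $\mathbf{B}=\mathbf{B}_{\mathrm{SCI}}(\omega_1)$.
   Context: $\mathbf{C}_A=\mathbf{P}_A+\mathbf{Q}_A$, $\mathbf{C}_B=\mathbf{P}_B+\mathbf{Q}_B$. For $\omega\in[0,1]$, $\bar\omega=1-\omega$: $\mathbf{B}_{\mathrm{SCI}}(\omega)^{-1}=\omega(\mathbf{P}_A+\omega\mathbf{Q}_A)^{-1}+\bar\omega(\mathbf{P}_B+\bar\omega\mathbf{Q}_B)^{-1}$. $\mathcal{A}_{\mathrm{Split}}=\{\mathbf{M} : \begin{bmatrix}\mathbf{P}_A & \mathbf{M}\\ \mathbf{M}^\intercal & \mathbf{P}_B\end{bmatrix}\succeq 0\}$. $\mathbf{C}_F(\mathbf{K},\mathbf{P}_{AB})=\mathbf{K}_A\mathbf{C}_A\mathbf{K}_A^\intercal+\mathbf{K}_A\mathbf{P}_{AB}\mathbf{K}_B^\intercal+\mathbf{K}_B\mathbf{P}_{AB}^\intercal\mathbf{K}_A^\intercal+\mathbf{K}_B\mathbf{C}_B\mathbf{K}_B^\intercal$ for $\mathbf{K}=(\mathbf{K}_A,\mathbf{K}_B)$. For $\mathbf{P}_{AB}\in\mathcal{A}_{\mathrm{Split}}$: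 $\mathbf{R}=\mathbf{C}_A+\mathbf{C}_B-\mathbf{P}_{AB}-\mathbf{P}_{AB}^\intercal$, $\mathbf{K}_A^*=(\mathbf{C}_B-\mathbf{P}_{AB}^\intercal)\mathbf{R}^{-1}$, $\mathbf{C}_F^*(\mathbf{P}_{AB})=\mathbf{C}_F((\mathbf{K}_A^*,\mathbf{I}-\mathbf{K}_A^* ),\mathbf{P}_{AB})$. For symmetric positive definite $\mathbf{P}$, $\mathcal{E}(\mathbf{P})=\{\mathbf{x}:\mathbf{x}^\intercal\mathbf{P}^{-1}\mathbf{x}\le1\}$. $\mathcal{V}^*=\bigcup_{\mathbf{P}_{AB}\in\mathcal{A}_{\mathrm{Split}}}\mathcal{E}(\mathbf{C}_F^*(\mathbf{P}_{AB}))$. An ellipsoid $\mathcal{E}(\mathbf{P})$ tightly circumscribes $\mathcal{V}^*$ if $\mathcal{V}^*\subseteq\mathcal{E}(\mathbf{P})$ and for every symmetric positive definite $\mathbf{Q}$, $\mathcal{V}^*\subseteq\mathcal{E}(\mathbf{Q})\subseteq\mathcal{E}(\mathbf{P})$ implies $\mathbf{Q}=\mathbf{P}$. *)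

(* Defs.v *)
From HB Require Import structures.
From mathcomp Require Import all_boot all_order all_algebra.
From mathcomp Require Import reals.
Set Implicit Arguments. Unset Strict Implicit. Unset Printing Implicit Defensive.
Import Order.TTheory GRing.Theory Num.Theory.
Local Open Scope ring_scope.

Section Defs.
Variable R : realType.

Definition qform (n : nat) (A : 'M[R]_n) (x : 'cV[R]_n) : R :=
  (x^T *m A *m x) 0 0.

Definition sym_mx (n : nat) (A : 'M[R]_n) : Prop := A^T = A.

Definition spd (n : nat) (A : 'M[R]_n) : Prop :=
  sym_mx A /\ forall x : 'cV[R]_n, x != 0 -> 0 < qform A x.

Definition psd (n : nat) (A : 'M[R]_n) : Prop :=
  sym_mx A /\ forall x : 'cV[R]_n, 0 <= qform A x.

Definition B_SCI (n : nat) (PA PB QA QB : 'M[R]_n) (w : R) : 'M[R]_n :=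
  invmx (w *: invmx (PA + w *: QA) + (1 - w) *: invmx (PB + (1 - w) *: QB)).

Definition A_split (n : nat) (PA PB : 'M[R]_n) (M : 'M[R]_n) : Prop :=
  psd (block_mx PA M M^T PB).

Definition C_F (n : nat) (CA CB : 'M[R]_n) (KA KB PAB : 'M[R]_n) : 'M[R]_n :=
  KA *m CA *m KA^T + KA *m PAB *m KB^T + KB *m PAB^T *m KA^T + KB *m CB *m KB^T.

(* C_F^*(P_AB) with the optimal gain K_A^* = (C_B - P_AB^T) R^{-1} *)
Definition C_F_star (n : nat) (PA PB QA QB PAB : 'M[R]_n) : 'M[R]_n :=
  let CA := PA + QA in
  let CB := PB + QB in
  let Rm := CA + CB - PAB - PAB^T in
  let KA := (CB - PAB^T) *m invmx Rm in
  C_F CA CB KA (1%:M - KA) PAB.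

Definition ellipsoid (n : nat) (P : 'M[R]_n) (x : 'cV[R]_n) : Prop :=
  qform (invmx P) x <= 1.

Definition V_star (n : nat) (PA PB QA QB : 'M[R]_n) (x : 'cV[R]_n) : Prop :=
  exists PAB, A_split PA PB PAB /\ ellipsoid (C_F_star PA PB QA QB PAB) x.

Definition subset_cV (n : nat) (S T : 'cV[R]_n -> Prop) : Prop :=
  forall x, S x -> T x.

Definition tightly_circumscribes (n : nat) (P : 'M[R]_n)
  (V : 'cV[R]_n -> Prop) : Prop :=
  subset_cV V (ellipsoid P) /\
  forall Q : 'M[R]_n, spd Q ->
    subset_cV V (ellipsoid Q) -> subset_cV (ellipsoid Q) (ellipsoid P) -> Q = P.

End Defs.

(* Main.v *)
(* A point x lies in V* as soon as, for some a and b,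
     max (a' PA^-1 a) (b' PB^-1 b) + (x-a)' QA^-1 (x-a) + (x-b)' QB^-1 (x-b) <= 1,
   the admissible cross-covariance being a b' / t with t the value of the max.
   Hence V* <= E(B) says that of two quadratic forms in (x, a, b) at least one
   is nonnegative everywhere.  By the homogeneous S-lemma (Yuan) some convex
   combination of them, with weight w, is nonnegative; minimising it over a
   and b yields B^-1 <= B_SCI(w)^-1.  As V* <= E(B_SCI(w)) for every w,
   tightness of B forces B = B_SCI(w). *)
Require Import Defs.
From HB Require Import structures.
From mathcomp Require Import all_boot all_order all_algebra.
From mathcomp Require Import boolp classical_sets reals.
From mathcomp Require Import ring lra.
Set Implicit Arguments. Unset Strict Implicit. Unset Printing Implicit Defensive.
Import Order.TTheory GRing.Theory Num.Theory.
Local Open Scope ring_scope.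

(** * Dot products, quadratic forms and positive definite matrices *)

Definition dotp (R : realType) (n : nat) (x y : 'cV[R]_n) : R := (x^T *m y) 0 0.

Lemma dotpDl (R : realType) n (x y z : 'cV[R]_n) :
  dotp (x + y) z = dotp x z + dotp y z.
Proof. by rewrite /dotp linearD mulmxDl mxE. Qed.

Lemma dotpDr (R : realType) n (x y z : 'cV[R]_n) :
  dotp z (x + y) = dotp z x + dotp z y.
Proof. by rewrite /dotp mulmxDr mxE. Qed.

Lemma dotpZl (R : realType) n (t : R) (x y : 'cV[R]_n) :
  dotp (t *: x) y = t * dotp x y.
Proof. by rewrite /dotp linearZ /= -scalemxAl mxE. Qed.

Lemma dotpZr (R : realType) n (t : R) (x y : 'cV[R]_n) :
  dotp x (t *: y) = t * dotp x y.
Proof. by rewrite /dotp -scalemxAr mxE. Qed.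

Lemma dotpNl (R : realType) n (x y : 'cV[R]_n) : dotp (- x) y = - dotp x y.
Proof. by rewrite -scaleN1r dotpZl mulN1r. Qed.

Lemma dotpNr (R : realType) n (x y : 'cV[R]_n) : dotp x (- y) = - dotp x y.
Proof. by rewrite -scaleN1r dotpZr mulN1r. Qed.

Lemma dotp0r (R : realType) n (x : 'cV[R]_n) : dotp x 0 = 0.
Proof. by rewrite /dotp mulmx0 mxE. Qed.

Lemma dotpC (R : realType) n (x y : 'cV[R]_n) : dotp x y = dotp y x.
Proof. by rewrite /dotp -[in RHS](trmxK x) -trmx_mul [RHS]mxE. Qed.

Lemma dotp_mulmx (R : realType) m n (A : 'M[R]_(m, n)) x y :
  dotp (A *m x) y = dotp x (A^T *m y).
Proof. by rewrite /dotp trmx_mul mulmxA. Qed.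

Lemma dotp_col_mx (R : realType) m n (x1 y1 : 'cV[R]_m) (x2 y2 : 'cV[R]_n) :
  dotp (col_mx x1 x2) (col_mx y1 y2) = dotp x1 y1 + dotp x2 y2.
Proof. by rewrite /dotp tr_col_mx mul_row_col mxE. Qed.

Lemma qformE (R : realType) n (A : 'M[R]_n) x : qform A x = dotp x (A *m x).
Proof. by rewrite /qform /dotp mulmxA. Qed.

Lemma qformDl (R : realType) n (A B : 'M[R]_n) x :
  qform (A + B) x = qform A x + qform B x.
Proof. by rewrite !qformE mulmxDl dotpDr. Qed.

Lemma qformZl (R : realType) n t (A : 'M[R]_n) x :
  qform (t *: A) x = t * qform A x.
Proof. by rewrite !qformE -scalemxAl dotpZr. Qed.

Lemma qformZ (R : realType) n t (A : 'M[R]_n) x :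
  qform A (t *: x) = t ^+ 2 * qform A x.
Proof. by rewrite !qformE -scalemxAr dotpZr dotpZl; ring. Qed.

Lemma qformN (R : realType) n (A : 'M[R]_n) x : qform A (- x) = qform A x.
Proof. by rewrite !qformE mulmxN dotpNl dotpNr opprK. Qed.

Lemma qform_mulmx (R : realType) m n (K : 'M[R]_(m, n)) (A : 'M[R]_n) x :
  qform (K *m A *m K^T) x = qform A (K^T *m x).
Proof. by rewrite !qformE dotp_mulmx trmxK !mulmxA. Qed.

Lemma qformD (R : realType) n (A : 'M[R]_n) x y : sym_mx A ->
  qform A (x + y) = qform A x + dotp x (A *m y) *+ 2 + qform A y.
Proof.
move=> sA; rewrite !qformE mulmxDr !(dotpDl, dotpDr).
by rewrite [dotp y (A *m x)]dotpC dotp_mulmx sA; ring.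
Qed.

Lemma qform_block (R : realType) n (A B M : 'M[R]_n) x y :
  qform (block_mx A M M^T B) (col_mx x y) =
  qform A x + dotp x (M *m y) *+ 2 + qform B y.
Proof.
rewrite !qformE mul_block_col dotp_col_mx !dotpDr.
by rewrite [dotp y (M^T *m x)]dotpC dotp_mulmx trmxK; ring.
Qed.

Lemma spd_ge0 (R : realType) n (A : 'M[R]_n) x : spd A -> 0 <= qform A x.
Proof.
case=> _ pA; have [->|/pA/ltW //] := eqVneq x 0.
by rewrite qformE mulmx0 dotp0r.
Qed.

Lemma spd_unitmx (R : realType) n (A : 'M[R]_n) : spd A -> A \in unitmx.
Proof.
case=> sA pA; rewrite unitmxE unitfE; apply/det0P => -[v v0 vA].
have := pA v^T; rewrite trmx_eq0 => /(_ v0).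
by rewrite /qform trmxK vA mul0mx mxE ltxx.
Qed.

Lemma qform_inv (R : realType) n (A : 'M[R]_n) x : spd A ->
  qform (invmx A) x = qform A (invmx A *m x).
Proof.
move=> sA; have uA := spd_unitmx sA.
rewrite !qformE mulmxA mulmxV // mul1mx.
by rewrite [RHS]dotpC.
Qed.

Lemma spd_inv (R : realType) n (A : 'M[R]_n) : spd A -> spd (invmx A).
Proof.
move=> sA; have uA := spd_unitmx sA; split.
  by rewrite /sym_mx trmx_inv sA.1.
move=> x x0; rewrite qform_inv //; apply: sA.2.
by apply: contraNneq x0 => e; rewrite -(mulKVmx uA x) e mulmx0.
Qed.

Lemma spdD (R : realType) n (A B : 'M[R]_n) : spd A -> spd B -> spd (A + B).
Proof.
move=> sA sB; split; first by rewrite /sym_mx linearD /= sA.1 sB.1.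
by move=> x x0; rewrite qformDl addr_gt0 ?sA.2 ?sB.2.
Qed.

Lemma spd_addZ (R : realType) n (t : R) (A B : 'M[R]_n) :
  0 <= t -> spd A -> spd B -> spd (A + t *: B).
Proof.
move=> t0 sA sB; split; first by rewrite /sym_mx linearD linearZ /= sA.1 sB.1.
by move=> x x0; rewrite qformDl qformZl ltr_wpDr ?mulr_ge0 ?spd_ge0 ?sA.2.
Qed.

Lemma spd_convex (R : realType) n (t : R) (A B : 'M[R]_n) :
  0 <= t <= 1 -> spd A -> spd B -> spd (t *: A + (1 - t) *: B).
Proof.
case/andP=> t0 t1 sA sB; split.
  by rewrite /sym_mx linearD !linearZ /= sA.1 sB.1.
move=> x x0; rewrite qformDl !qformZl.
have := sA.2 x x0; have := sB.2 x x0; nra.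
Qed.

(** For [y != 0], the form at [qform A y *: x - dotp x (A *m y) *: y] is nonnegative and equals
    [qform A y] times the gap of the inequality. *)
Lemma cauchy_schwarz (R : realType) n (A : 'M[R]_n) x y : spd A ->
  dotp x (A *m y) ^+ 2 <= qform A x * qform A y.
Proof.
move=> sA; have [->|y0] := eqVneq y 0.
  by rewrite (qformE A 0) !mulmx0 !dotp0r mulr0 expr0n.
have q0 := sA.2 y y0.
have := spd_ge0 (qform A y *: x + (- dotp x (A *m y)) *: y) sA.
rewrite (qformD _ _ sA.1) !qformZ -scalemxAr dotpZl dotpZr.
move: (qform A y) (qform A x) (dotp _ _) q0 => a b c a0.
rewrite (_ : _ + _ = a * (b * a - c ^+ 2)); last by ring.
by rewrite pmulr_rge0 // subr_ge0.
Qed.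

Lemma cauchy_schwarz_inv (R : realType) n (A : 'M[R]_n) x y : spd A ->
  dotp x y ^+ 2 <= qform A x * qform (invmx A) y.
Proof.
move=> sA; rewrite qform_inv //.
by rewrite -{1}(mulKVmx (spd_unitmx sA) y) cauchy_schwarz.
Qed.

(** * Quadratic functions on lines and the S-lemma *)

(** A quadratic form seen through its restrictions to lines. The leading coefficient [f y] makes it
    homogeneous, and the encoding applies directly to triples of vectors. *)
Definition quadratic (R : realType) (V : lmodType R) (f : V -> R) : Prop :=
  forall x y, exists m, forall t, f (x + t *: y) = f x + t * m + t ^+ 2 * f y.

Lemma quadratic_qform (R : realType) (V : lmodType R) n (A : 'M[R]_n)
  (g : V -> 'cV[R]_n) : sym_mx A ->
  (forall x y t, g (x + t *: y) = g x + t *: g y) ->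
  quadratic (fun v => qform A (g v)).
Proof.
move=> sA gE x y; exists (dotp (g x) (A *m g y) *+ 2) => t.
by rewrite gE qformD // qformZ -scalemxAr dotpZr; ring.
Qed.

Lemma quadraticD (R : realType) (V : lmodType R) (f g : V -> R) :
  quadratic f -> quadratic g -> quadratic (fun v => f v + g v).
Proof.
move=> qf qg x y; have [m fE] := qf x y; have [k gE] := qg x y.
by exists (m + k) => t; rewrite fE gE; ring.
Qed.

Lemma quadraticZ (R : realType) (V : lmodType R) c (f : V -> R) :
  quadratic f -> quadratic (fun v => c * f v).
Proof.
by move=> qf x y; have [m fE] := qf x y; exists (c * m) => t; rewrite fE; ring.
Qed.

(* The product of the two roots is a / c < 0, so both signs occur. *)
Lemma quadratic_root_sign (R : realType) (a b c m : R) : a < 0 -> 0 < c ->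
  exists2 t, a + t * b + t ^+ 2 * c = 0 & t * m <= 0.
Proof.
move=> a0 c0; pose d := b ^+ 2 - 4 * a * c; pose s := Num.sqrt d.
have bd : b ^+ 2 <= d by rewrite /d; nra.
have s2 : s ^+ 2 = d by rewrite sqr_sqrtr // (le_trans (sqr_ge0 b)).
have s0 : 0 <= s by exact: sqrtr_ge0.
have [bs sb] : - s <= b /\ b <= s by move: s2 s0 bd; clear; split; nra.
have c2 : 0 <= (2 * c)^-1 by rewrite invr_ge0; lra.
have c1 : c != 0 by rewrite gt_eqF.
(* Since [- s <= b <= s], the root with [- s] is nonpositive and the one with [+ s] nonnegative; the
   root of sign opposite to [m] is taken. *)
have [m0|/ltW m0] := leP 0 m.
  exists ((- b - s) * (2 * c)^-1); last first.
    by move: (2 * c)^-1 c2 => e e0; rewrite mulrAC mulr_le0_ge0 //; nra.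
  rewrite (_ : _ + _ = a + (s ^+ 2 - b ^+ 2) / (4 * c)); last by field.
  by rewrite s2 /d; field.
exists ((- b + s) * (2 * c)^-1); last first.
  by move: (2 * c)^-1 c2 => e e0; rewrite mulrAC mulr_le0_ge0 //; nra.
rewrite (_ : _ + _ = a + (s ^+ 2 - b ^+ 2) / (4 * c)); last by field.
by rewrite s2 /d; field.
Qed.

(* On the line x + t y, choosing t where f = g and where the cross term of the
   combination is nonpositive would make f and g both negative. *)
Lemma quadratic_cross (R : realType) (V : lmodType R) (f g : V -> R) w x y :
  quadratic f -> quadratic g -> (forall v, 0 <= f v \/ 0 <= g v) ->
  f x < 0 -> g y < 0 -> w * f x + (1 - w) * g x < 0 ->
  0 <= w * f y + (1 - w) * g y.
Proof.
move=> qf qg fg fx gy Gx; rewrite leNgt; apply/negP => Gy.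
have gx : 0 <= g x by case: (fg x) => //; lra.
have fy : 0 <= f y by case: (fg y) => //; lra.
have [mf fE] := qf x y; have [mg gE] := qg x y.
have d0 : f x - g x < 0 by lra.
have d1 : 0 < f y - g y by lra.
have [t tD tG] :=
  quadratic_root_sign (mf - mg) (w * mf + (1 - w) * mg) d0 d1.
have fg_eq : f (x + t *: y) = g (x + t *: y) by rewrite fE gE; lra.
have t2 : t ^+ 2 * (w * f y + (1 - w) * g y) <= 0.
  by rewrite mulr_ge0_le0 ?sqr_ge0 // ltW.
have : f (x + t *: y) < 0.
  rewrite (_ : f _ = w * f (x + t *: y) + (1 - w) * g (x + t *: y)).
    by rewrite fE gE; lra.
  by rewrite -fg_eq; ring.
by case: (fg (x + t *: y)); rewrite -?fg_eq; lra.
Qed.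

(* Each v with g v < 0 <= f v bounds the admissible weights from below by
   - g v / (f v - g v), and each v with f v < 0 <= g v from above by the same
   expression; the weight is the supremum of the lower bounds. *)
Lemma s_lemma (R : realType) (V : lmodType R) (f g : V -> R) :
  quadratic f -> quadratic g -> (forall v, 0 <= f v \/ 0 <= g v) ->
  exists w, 0 <= w <= 1 /\ forall v, 0 <= w * f v + (1 - w) * g v.
Proof.
move=> qf qg fg.
have gap v : g v < 0 -> 0 < f v - g v by case: (fg v); lra.
have [[y0 gy0]|gpos] := pselect (exists y, g y < 0); last first.
  exists 0; split=> [|v]; first lra.
  by rewrite mul0r subr0 add0r mul1r leNgt; apply/negP => ?; apply: gpos; exists v.
pose E := [set r : R | exists2 y, g y < 0 & r = - g y / (f y - g y)]%classic.
have E1 : ubound E 1.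
  move=> _ [y gy ->]; rewrite ler_pdivrMr ?gap // mul1r.
  by case: (fg y); lra.
have E0 r : E r -> 0 <= r.
  by case=> y gy ->; rewrite divr_ge0 ?ltW ?gap // oppr_gt0.
have Ey0 : E (- g y0 / (f y0 - g y0)) by exists y0.
have hE : has_sup E by split; [exists (- g y0 / (f y0 - g y0)) | exists 1].
exists (sup E); split.
  apply/andP; split; last by apply: sup_le_ub => //; exists (- g y0 / (f y0 - g y0)).
  by apply: le_trans (E0 _ Ey0) _; apply: sup_upper_bound.
move=> v; have [gv|gv] := ltP (g v) 0.
  have : - g v / (f v - g v) <= sup E by apply: sup_upper_bound => //; exists v.
  by rewrite ler_pdivrMr ?gap //; lra.
have [fv|fv] := ltP (f v) 0; last first.
  have s0 : 0 <= sup E by apply: le_trans (E0 _ Ey0) _; apply: sup_upper_bound.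
  have s1 : sup E <= 1 by apply: sup_le_ub => //; exists (- g y0 / (f y0 - g y0)).
  nra.
have d0 : 0 < g v - f v by lra.
suff : sup E <= g v / (g v - f v) by rewrite ler_pdivlMr //; lra.
apply: sup_le_ub; first by exists (- g y0 / (f y0 - g y0)).
move=> _ [y gy ->]; rewrite leNgt; apply/negP.
set h1 := g v / _; set h2 := - g y / _ => h12.
have h1E : h1 * (g v - f v) = g v by rewrite /h1 mulfVK ?gt_eqF.
have h2E : h2 * (f y - g y) = - g y by rewrite /h2 mulfVK ?gt_eqF ?gap.
have dy := gap _ gy.
(* If an upper bound [h1] lay below a lower bound [h2], their midpoint would make the combination
   negative at both [v] and [y]. *)
have := quadratic_cross (w := (h1 + h2) / 2) qf qg fg fv gy.
have : 0 < (h2 - h1) * (g v - f v) by rewrite mulr_gt0 // subr_gt0.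
have : 0 < (h2 - h1) * (f y - g y) by rewrite mulr_gt0 // subr_gt0.
move=> p1 p2 p3.
have /p3 : (h1 + h2) / 2 * f v + (1 - (h1 + h2) / 2) * g v < 0 by lra.
lra.
Qed.

(** * Ellipsoids, admissible cross-covariances and fused covariances *)

(** The support function description: membership becomes monotone in the form of [C], with no
    inverse. The converse tests [y = invmx C *m x], where the bound reads [q ^+ 2 <= q]. *)
Lemma ellipsoidP (R : realType) n (C : 'M[R]_n) x : spd C ->
  ellipsoid C x <-> forall y, dotp y x ^+ 2 <= qform C y.
Proof.
move=> sC; rewrite /ellipsoid; split=> [Cx y|Cx].
  apply: le_trans (cauchy_schwarz_inv y x sC) _.
  by rewrite ler_piMr // spd_ge0.
have := Cx (invmx C *m x); rewrite -qform_inv // dotpC -qformE; nra.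
Qed.

Lemma A_split_ge0 (R : realType) n (PA PB M : 'M[R]_n) x y :
  A_split PA PB M -> 0 <= qform PA x + dotp x (M *m y) *+ 2 + qform PB y.
Proof. by case=> _ /(_ (col_mx x y)); rewrite qform_block. Qed.

(** With [r = dotp x a] and [s = dotp y b], Cauchy-Schwarz bounds [r ^+ 2] and [s ^+ 2] by [t] times
    the diagonal terms. The choice of [M] supplies exactly the cross term [2 r s]. *)
Lemma A_split_outer (R : realType) n (PA PB : 'M[R]_n) (a b : 'cV[R]_n) t :
  spd PA -> spd PB -> qform (invmx PA) a <= t -> qform (invmx PB) b <= t ->
  exists2 M, A_split PA PB M &
    forall x y, (dotp x a + dotp y b) ^+ 2 <=
      t * (qform PA x + dotp x (M *m y) *+ 2 + qform PB y).
Proof.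
move=> sPA sPB at_ bt; pose M := t^-1 *: (a *m b^T).
have t0 : 0 <= t by apply: le_trans at_; apply: spd_ge0; apply: spd_inv.
have ME x y : dotp x (M *m y) = t^-1 * (dotp x a * dotp y b).
  rewrite /M -scalemxAl dotpZr -mulmxA [b^T *m y]mx11_scalar mul_mx_scalar.
  by rewrite dotpZr -/(dotp b y) [dotp b y]dotpC [dotp y b * _]mulrC.
have CSt (P : 'M[R]_n) u v : spd P -> qform (invmx P) v <= t -> dotp u v ^+ 2 <= t * qform P u.
  move=> sP vt; apply: le_trans (cauchy_schwarz_inv u v sP) _.
  by rewrite mulrC ler_wpM2r // spd_ge0.
have key x y : 0 <= qform PA x + dotp x (M *m y) *+ 2 + qform PB y /\
    (dotp x a + dotp y b) ^+ 2 <=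
      t * (qform PA x + dotp x (M *m y) *+ 2 + qform PB y).
  rewrite ME; have := CSt PA x a sPA at_; have := CSt PB y b sPB bt.
  have := spd_ge0 x sPA; have := spd_ge0 y sPB.
  move: (qform PA x) (qform PB y) (dotp x a) (dotp y b) => p q r s q0 p0 hs hr.
  (* At [t = 0] the inverse is [0] by convention, so the cross term vanishes, and the bounds force
     both dot products to be [0]. *)
  move: t0; rewrite le_eqVlt => /predU1P[te|tp].
    rewrite -te !mul0r in hr hs *; rewrite invr0 !mul0r mul0rn.
    have r0 : r = 0 by nra.
    have s0 : s = 0 by nra.
    by rewrite r0 s0; lra.
  have e : t * (p + t^-1 * (r * s) *+ 2 + q) = t * p + (r * s) *+ 2 + t * q.
    by field; rewrite gt_eqF.
  have h : (r + s) ^+ 2 <= t * (p + t^-1 * (r * s) *+ 2 + q) by rewrite e; nra.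
  by split=> //; rewrite -(pmulr_rge0 _ tp) (le_trans _ h) // sqr_ge0.
exists M => [|x y]; last by case: (key x y).
split; first by rewrite /sym_mx tr_block_mx trmxK sPA.1 sPB.1.
by move=> z; rewrite -[z]vsubmxK qform_block; case: (key (usubmx z) (dsubmx z)).
Qed.

(** Reduces estimates on fused covariances to the joint form at the pair [K^T *m y], [L^T *m y], a
    splitting of [y] when [K + L = 1%:M]. *)
Lemma qform_C_F (R : realType) n (CA CB K L M : 'M[R]_n) y :
  qform (C_F CA CB K L M) y =
  qform CA (K^T *m y) + dotp (K^T *m y) (M *m (L^T *m y)) *+ 2
  + qform CB (L^T *m y).
Proof.
rewrite /C_F !qformDl !qform_mulmx dotp_mulmx trmxK.
have -> : qform (L *m M^T *m K^T) y = qform (K *m M *m L^T) y.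
  by rewrite !qformE dotpC dotp_mulmx !trmx_mul !trmxK mulmxA.
by rewrite (qformE (K *m M *m L^T)) !mulmxA mulr2n addrA.
Qed.

(** The split part is only semidefinite; strictness comes from [QA] or [QB], as the two parts of a
    nonzero [y] cannot both vanish. *)
Lemma C_F_spd (R : realType) n (PA PB QA QB K L M : 'M[R]_n) :
  spd PA -> spd PB -> spd QA -> spd QB -> A_split PA PB M -> K + L = 1%:M ->
  spd (C_F (PA + QA) (PB + QB) K L M).
Proof.
move=> sPA sPB sQA sQB sM KL; split.
  have trD (A C : 'M[R]_n) : (A + C)^T = A^T + C^T by rewrite linearD.
  rewrite /sym_mx /C_F 3!trD !trmx_mul !trmxK (spdD sPA sQA).1 (spdD sPB sQB).1.
  rewrite !mulmxA -!addrA; congr (_ + _).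
  by rewrite addrCA.
move=> y y0; rewrite qform_C_F !qformDl.
have := A_split_ge0 (K^T *m y) (L^T *m y) sM.
have : K^T *m y + L^T *m y = y by rewrite -mulmxDl -linearD /= KL trmx1 mul1mx.
have [k0|/sQA.2] := eqVneq (K^T *m y) 0; last first.
  by have := spd_ge0 (L^T *m y) sQB; lra.
rewrite k0 add0r => ly; have := sQB.2 _ y0; have := spd_ge0 0 sQA; rewrite ly; lra.
Qed.

(** * Optimality of the gain and the bound by [B_SCI] *)

Section SplitCovariance.
Variables (R : realType) (n : nat) (PA PB QA QB M : 'M[R]_n).
Hypotheses (sPA : spd PA) (sPB : spd PB) (sQA : spd QA) (sQB : spd QB).
Hypothesis sM : A_split PA PB M.

Lemma C_F_star_spd : spd (C_F_star PA PB QA QB M).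
Proof. by apply: C_F_spd => //; rewrite addrC subrK. Qed.

(** Completing the square: for fixed [y] the joint form [J] is minimised over splittings of [y]. The
    excess over the stationary splitting is [J d (- d)]. *)
Lemma C_F_star_min K y :
  qform (C_F_star PA PB QA QB M) y <=
  qform (C_F (PA + QA) (PB + QB) K (1%:M - K) M) y.
Proof.
pose CA := PA + QA; pose CB := PB + QB.
have sCA : spd CA by exact: spdD.
have sCB : spd CB by exact: spdD.
pose J x z := qform CA x + dotp x (M *m z) *+ 2 + qform CB z.
have Jge x z : qform QA x + qform QB z <= J x z.
  by have := A_split_ge0 x z sM; rewrite /J !qformDl; lra.
pose S := CA + CB - M - M^T.
have symS : S^T = S.
  by rewrite /S !linearB /= linearD /= trmxK sCA.1 sCB.1 addrAC.
(* [S] is the joint form on pairs [(x, - x)], the directions that keep the sum of a splitting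
   fixed. *)
have S_gt0 x : x != 0 -> 0 < qform S x.
  move=> x0; have : qform S x = J x (- x).
    rewrite /J qformN mulmxN dotpNr !qformE /S !(mulmxDl, mulNmx).
    by rewrite !(dotpDr, dotpNr) (dotpC x (M^T *m x)) dotp_mulmx trmxK; ring.
  by move->; apply: lt_le_trans (Jge _ _); rewrite qformN addr_gt0 ?sQA.2 ?sQB.2.
have uS : S \in unitmx by apply: spd_unitmx.
pose KA := (CB - M^T) *m invmx S.
rewrite /C_F_star -/CA -/CB -/S -/KA !qform_C_F -/(J _ _) -/(J _ _).
pose w := KA^T *m y.
have Sw : S *m w = (CB - M) *m y.
  rewrite /w /KA trmx_mul trmx_inv symS linearB /= trmxK sCB.1.
  by rewrite !mulmxA mulmxV // mul1mx.
have comp (L : 'M[R]_n) : (1%:M - L)^T *m y = y - L^T *m y.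
  by rewrite linearB /= trmx1 mulmxBl mul1mx.
rewrite !comp -/w.
rewrite -[K^T *m y](subrK w); move: (K^T *m y - w) => d.
clearbody w.
have -> : y - (d + w) = - d + (y - w) by rewrite opprD addrCA.
(* The cross term vanishes by Sw, the stationarity of the optimal gain. *)
have -> : J (d + w) (- d + (y - w)) = J w (y - w) + J d (- d) +
    dotp d (S *m w - (CB - M) *m y) *+ 2.
  rewrite /J (qformD d w sCA.1) (qformD (- d) (y - w) sCB.1) /S.
  rewrite !(mulmxDl, mulmxDr, mulNmx, mulmxN) !(dotpDl, dotpDr, dotpNl, dotpNr).
  rewrite (dotpC d (M^T *m w)) dotp_mulmx trmxK.
  by rewrite !(mulmxDl, mulmxDr, mulNmx, mulmxN, opprD, opprK,
               dotpDl, dotpDr, dotpNl, dotpNr); ring.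
rewrite Sw subrr dotp0r mul0rn addr0 lerDl.
by apply: le_trans (Jge _ _); rewrite addr_ge0 ?spd_ge0.
Qed.

Variable w : R.
Hypothesis w01 : 0 <= w <= 1.
Let FA := PA + w *: QA.
Let FB := PB + (1 - w) *: QB.
Let S := w *: invmx FA + (1 - w) *: invmx FB.

Lemma spd_FA : spd FA. Proof. by case/andP: w01 => w0 _; apply: spd_addZ. Qed.

Lemma spd_FB : spd FB.
Proof. by case/andP: w01 => _ w1; apply: spd_addZ; rewrite ?subr_ge0. Qed.

Lemma spd_S : spd S.
Proof. by apply: spd_convex => //; apply: spd_inv; [exact: spd_FA|exact: spd_FB]. Qed.

(** By optimality one gain suffices: [K] below is the gain of split covariance intersection, whose
    complement has the same shape. *)
Lemma C_F_star_le_B_SCI y :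
  qform (C_F_star PA PB QA QB M) y <= qform (B_SCI PA PB QA QB w) y.
Proof.
rewrite /B_SCI -/FA -/FB -/S.
have sA := spd_FA; have sB := spd_FB; have sS := spd_S.
pose K := invmx S *m (w *: invmx FA).
have KC : 1%:M - K = invmx S *m ((1 - w) *: invmx FB).
  apply/eqP; rewrite subr_eq /K -mulmxDr addrC -/S mulVmx //.
  exact: spd_unitmx.
apply: le_trans (C_F_star_min K y) _.
rewrite qform_C_F KC /K !trmx_mul !linearZ /= (spd_inv sA).1 (spd_inv sB).1.
rewrite (spd_inv sS).1 -!mulmxA -!scalemxAl (qform_inv _ sS).
set g := invmx S *m y; rewrite /S (qformDl (w *: _)) (qformZl w) (qformZl (1 - w)).
rewrite (qform_inv g sA) (qform_inv g sB).
rewrite -scalemxAr dotpZr dotpZl !qformZ !qformDl !qformZl.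
set a := invmx FA *m g; set b := invmx FB *m g.
(* The difference of the two sides is [w * (1 - w)] times the split form at [(a, - b)]. *)
have := A_split_ge0 a (- b) sM; rewrite qformN mulmxN dotpNr.
case/andP: w01 => w0 w1 /(mulr_ge0 (mulr_ge0 w0 (_ : 0 <= 1 - w))).
by rewrite subr_ge0 => /(_ w1); lra.
Qed.

Lemma B_SCI_spd : spd (B_SCI PA PB QA QB w).
Proof. exact: spd_inv spd_S. Qed.

(** The witnesses are the stationary points of the right side in [a] and [b]: [PA *m invmx FA *m x]
    leaves the residual [w *: (QA *m invmx FA *m x)], and symmetrically for [b]. *)
Lemma qform_inv_B_SCI x : exists a b,
  qform (invmx (B_SCI PA PB QA QB w)) x =
  w * qform (invmx PA) a + (1 - w) * qform (invmx PB) b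
  + qform (invmx QA) (x - a) + qform (invmx QB) (x - b).
Proof.
have sA := spd_FA; have sB := spd_FB.
have uPA := spd_unitmx sPA; have uPB := spd_unitmx sPB.
have uQA := spd_unitmx sQA; have uQB := spd_unitmx sQB.
rewrite /B_SCI -/FA -/FB -/S invmxK.
pose a := invmx FA *m x; pose b := invmx FB *m x.
have xA : x - PA *m a = w *: (QA *m a).
  by rewrite -{1}(mulKVmx (spd_unitmx sA) x) -/a mulmxDl -scalemxAl addrC addKr.
have xB : x - PB *m b = (1 - w) *: (QB *m b).
  by rewrite -{1}(mulKVmx (spd_unitmx sB) x) -/b mulmxDl -scalemxAl addrC addKr.
exists (PA *m a), (PB *m b).
rewrite xA xB !qformZ (qform_inv _ sPA) (qform_inv _ sPB) (qform_inv _ sQA).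
rewrite (qform_inv _ sQB) !mulKmx // /S qformDl !qformZl (qform_inv _ sA).
by rewrite (qform_inv _ sB) -/a -/b !qformDl !qformZl; ring.
Qed.
End SplitCovariance.

(** * Points of [V_star] and its enclosing ellipsoids *)

(** The cross term satisfies [(2 p q)^2 <= 4 (s Q) (t P) <= (s Q + t P)^2]. *)
Lemma sqr_add_le (R : realType) (p q s t P Q : R) :
  0 <= s -> 0 <= t -> 0 <= P -> 0 <= Q ->
  p ^+ 2 <= s * P -> q ^+ 2 <= t * Q -> (p + q) ^+ 2 <= (s + t) * (P + Q).
Proof.
move=> s0 t0 P0 Q0 hp hq.
have h0 : 0 <= s * Q + t * P by rewrite addr_ge0 // mulr_ge0.
suff : (p * q) *+ 2 <= s * Q + t * P by nra.
rewrite leNgt; apply/negP => h.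
have h2 : (s * Q + t * P) ^+ 2 < ((p * q) *+ 2) ^+ 2.
  by rewrite ltr_pXn2r // nnegrE (le_trans h0) // ltW.
have : p ^+ 2 * q ^+ 2 <= (s * P) * (t * Q).
  by apply: ler_pM => //; exact: sqr_ge0.
have := sqr_ge0 (s * Q - t * P); lra.
Qed.

Lemma V_star_intro (R : realType) n (PA PB QA QB : 'M[R]_n) x a b t :
  spd PA -> spd PB -> spd QA -> spd QB ->
  qform (invmx PA) a <= t -> qform (invmx PB) b <= t ->
  t + qform (invmx QA) (x - a) + qform (invmx QB) (x - b) <= 1 ->
  V_star PA PB QA QB x.
Proof.
move=> sPA sPB sQA sQB at_ bt le1.
have t0 : 0 <= t by apply: le_trans at_; apply: spd_ge0; exact: spd_inv.
have [M sM Mt] := A_split_outer sPA sPB at_ bt.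
exists M; split=> //; apply/ellipsoidP => [|y]; first exact: C_F_star_spd.
rewrite /C_F_star; set K := _ *m invmx _.
rewrite qform_C_F; set y1 := K^T *m y; set y2 := _ *m y.
have yE : y = y1 + y2.
  by rewrite -mulmxDl -linearD /= addrC subrK trmx1 mul1mx.
(* Each of the three terms has its own Cauchy-Schwarz bound; [sqr_add_le] adds them, and the weights
   sum to at most [1]. *)
have -> : dotp y x = (dotp y1 a + dotp y2 b) + dotp y1 (x - a) + dotp y2 (x - b).
  by rewrite {1}yE !dotpDl !dotpDr !dotpNr; ring.
have J0 := A_split_ge0 y1 y2 sM.
have A0 := spd_ge0 y1 sQA; have B0 := spd_ge0 y2 sQB.
have a0 := spd_ge0 (x - a) (spd_inv sQA).
have b0 := spd_ge0 (x - b) (spd_inv sQB).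
have hA := cauchy_schwarz_inv y1 (x - a) sQA.
have hB := cauchy_schwarz_inv y2 (x - b) sQB.
rewrite mulrC in hA; rewrite mulrC in hB.
have h1 := sqr_add_le t0 a0 J0 A0 (Mt y1 y2) hA.
have h2 := sqr_add_le (addr_ge0 t0 a0) b0 (addr_ge0 J0 A0) B0 h1 hB.
apply: (le_trans h2); apply: (@le_trans _ _ (1 * _)).
  by apply: ler_wpM2r le1; apply: addr_ge0 B0; apply: addr_ge0 J0 A0.
by rewrite !qformDl; lra.
Qed.

(** Homogeneous counterpart of [V_star_intro]: a comparison of forms for all [x], [a], [b], as the
    S-lemma requires. *)
Lemma V_star_sub_ellipsoid (R : realType) n (PA PB QA QB B : 'M[R]_n) x a b t :
  spd PA -> spd PB -> spd QA -> spd QB ->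
  subset_cV (V_star PA PB QA QB) (ellipsoid B) ->
  qform (invmx PA) a <= t -> qform (invmx PB) b <= t ->
  qform (invmx B) x <= t + qform (invmx QA) (x - a) + qform (invmx QB) (x - b).
Proof.
move=> sPA sPB sQA sQB VB at_ bt; set r := t + _ + _; rewrite leNgt; apply/negP => rx.
have t0 : 0 <= t by apply: le_trans at_; apply: spd_ge0; exact: spd_inv.
have r0 : 0 <= r by rewrite !addr_ge0 // spd_ge0 //; exact: spd_inv.
(* Rescale x so that r falls below 1 and the form of B above 1. *)
pose m := (r + qform (invmx B) x) / 2.
have m0 : 0 < m by rewrite /m; lra.
pose c := Num.sqrt m^-1.
have c2 : c ^+ 2 = m^-1 by rewrite sqr_sqrtr // invr_ge0 ltW.
have ci : 0 <= c ^+ 2 by exact: sqr_ge0.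
have : ellipsoid B (c *: x).
  apply: VB; apply: (@V_star_intro _ _ _ _ _ _ _ (c *: a) (c *: b) (c ^+ 2 * t)) => //.
  - by rewrite qformZ ler_wpM2l.
  - by rewrite qformZ ler_wpM2l.
  - rewrite -!scalerBr !qformZ -!mulrDr -/r c2 mulrC ler_pdivrMr // mul1r /m; lra.
by rewrite /ellipsoid qformZ c2 mulrC ler_pdivrMr // mul1r /m; lra.
Qed.

Lemma V_star_sub_B_SCI (R : realType) n (PA PB QA QB : 'M[R]_n) w :
  spd PA -> spd PB -> spd QA -> spd QB -> 0 <= w <= 1 ->
  subset_cV (V_star PA PB QA QB) (ellipsoid (B_SCI PA PB QA QB w)).
Proof.
move=> sPA sPB sQA sQB w01 x [M [sM]].
move=> /(ellipsoidP _ (C_F_star_spd sPA sPB sQA sQB sM)) Cx.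
apply/ellipsoidP; first exact: B_SCI_spd.
by move=> y; apply: le_trans (Cx y) _; exact: C_F_star_le_B_SCI.
Qed.

Theorem theorem3 (R : realType) (n : nat) (PA PB QA QB B : 'M[R]_n) :
  (0 < n)%N ->
  spd PA -> spd PB -> spd QA -> spd QB -> spd B ->
  tightly_circumscribes B (V_star PA PB QA QB) ->
  exists w1 : R, 0 <= w1 <= 1 /\ B = B_SCI PA PB QA QB w1.
Proof.
move=> _ sPA sPB sQA sQB sB [VB tight].
pose V := ('cV[R]_n * 'cV[R]_n * 'cV[R]_n)%type.
(* A triple [v] is [(x, a, b)]. The part [h] is common to [f] and [g], so every convex combination
   contains it exactly once. *)
pose h (v : V) := qform (invmx QA) (v.1.1 - v.1.2) +
  qform (invmx QB) (v.1.1 - v.2) + - 1 * qform (invmx B) v.1.1.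
pose f (v : V) := qform (invmx PA) v.1.2 + h v.
pose g (v : V) := qform (invmx PB) v.2 + h v.
have qh : quadratic h.
  apply: quadraticD; first apply: quadraticD.
  - apply: quadratic_qform => [|x y t]; first exact: (spd_inv sQA).1.
    by rewrite /= scalerBr opprD addrACA.
  - apply: quadratic_qform => [|x y t]; first exact: (spd_inv sQB).1.
    by rewrite /= scalerBr opprD addrACA.
  - by apply: quadraticZ; apply: quadratic_qform => //; exact: (spd_inv sB).1.
have qf : quadratic f.
  by apply: quadraticD => //; apply: quadratic_qform => //; exact: (spd_inv sPA).1.
have qg : quadratic g.
  by apply: quadraticD => //; apply: quadratic_qform => //; exact: (spd_inv sPB).1.
have fg v : 0 <= f v \/ 0 <= g v.
  case: v => [[x a] b]; rewrite /f /g /h /=.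
  (* The larger of the two forms serves as [t]. *)
  have [ab|/ltW ba] := leP (qform (invmx PA) a) (qform (invmx PB) b).
  - right; have := V_star_sub_ellipsoid x sPA sPB sQA sQB VB ab (lexx _); lra.
  - left; have := V_star_sub_ellipsoid x sPA sPB sQA sQB VB (lexx _) ba; lra.
have [w [w01 wfg]] := s_lemma qf qg fg.
exists w; split=> //; apply/esym; apply: tight.
- exact: B_SCI_spd.
- exact: V_star_sub_B_SCI.
(* At the [a], [b] that attain the form of the inverse of [B_SCI], nonnegativity of the combination
   says that it dominates the form of [invmx B]. *)
move=> x; rewrite /ellipsoid; apply: le_trans.
have [a [b ->]] := qform_inv_B_SCI sPA sPB sQA sQB w01 x.
by have := wfg (x, a, b); rewrite /f /g /h /=; lra.
Qed.
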